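(* Let $\mathcal D$ be a dense linear subspace of a complex Hilbert space $\mathcal H$ and let $\mathcal A,\mathcal B\subset\mathcal L^+(\mathcal D)$ be standard operator $*$-algebras on $\mathcal D$. Suppose that $\Phi\colon\mathcal A\to\mathcal B$ is a bijective linear mapping such that $$\Phi(AB^+A)=\Phi(A)\Phi(B)^+\Phi(A)\quad\text{for all }A,B\in\mathcal A.$$ Then either there are unitary operators $U,V\in\mathcal L^+(\mathcal D)$ such that $$\Phi(A)=UAV\quad\text{for all }A\in\mathcal A,$$ or there are antiunitary operators $U',V'$ (mapping $\mathcal D$ onto $\mathcal D$) such that $$\Phi(A)=U'A^+V'\quad\text{for all }A\in\mathcal A.$$
   Context: For a dense linear subspace $\mathcal D$ of a complex Hilbert space $\mathcal H$, $\mathcal L^+(\mathcal D)$ denotes the set of all linear operators $A\colon\mathcal D\to\mathcal D$ whose Hilbert space adjoint $A^*$ is defined on $\mathcal D$ and satisfies $A^*\mathcal D\subset\mathcal D$. It is a $*$-algebra with the usual operations and the involution $A\mapsto A^+:=A^*|_{\mathcal D}$. $\mathcal F(\mathcal D)\subset\mathcal L^+(\mathcal D)$ is the ideal of all finite rank operators in $\mathcal L^+(\mathcal D)$. A standard operator $*$-algebra on $\mathcal D$ is a (complex) $*$-subalgebra of $\mathcal L^+(\mathcal D)$ containing $\mathcal F(\mathcal D)$. An operator on $\mathcal D$ is called unitary (antiunitary) if its closure, i.e. continuous extension to $\mathcal H$, is a unitary (antiunitary) operator on $\mathcal H$. No further assumption (such as completeness in the graph topology) is made on $\mathcal D$. 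*)

(* Defs.v *)
From HB Require Import structures.
From mathcomp Require Import all_boot all_order all_algebra.
From mathcomp Require Import complex.
From mathcomp Require Import all_classical all_reals all_analysis.
Set Implicit Arguments.
Unset Strict Implicit.
Unset Printing Implicit Defensive.
Import Order.TTheory GRing.Theory Num.Theory.
Import numFieldNormedType.Exports.
Local Open Scope classical_set_scope.
Local Open Scope ring_scope.

(* A complex Hilbert space is a complete normed space H over R[i] with an inner
   product dot : {dot H for Num.conj} such that dot x x = `|x| ^+ 2; dot is
   linear in its first argument and conjugate-linear in the second. *)

Section Domain.
Context {K : pzRingType} {H : lmodType K}.

(* The linear subspace D as a K-module in its own right. *)
Inductive dom (D : submodClosed H) : predArgType := Dom x & x \in D.

Definition dom_val (D : submodClosed H) (u : dom D) : H := let: Dom x _ := u in x.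

Context (D : submodClosed H).
HB.instance Definition _ := [isSub of dom D for @dom_val D].
HB.instance Definition _ := [Choice of dom D by <:].
HB.instance Definition _ := [SubChoice_isSubLmodule of dom D by <:].
End Domain.

Section Operators.
Context {R : realType} {H : completeNormedModType R[i]}.
Context (dot : {dot H for Num.conj}) (D : submodClosed H).
Implicit Types (A B : dom D -> dom D) (W : H -> H).

Definition adj_rel A (y z : H) : Prop := forall x : dom D, dot (val (A x)) y = dot (val x) z.

Definition adj_dom A : set H := [set y | exists z, adj_rel A y z].

(* The value A^* y; z is unique because D is dense.  The value is 0 for y outside
   adj_dom A. *)
Definition adj A (y : H) : H := xget 0 [set z | adj_rel A y z].

Definition Lplus : set (dom D -> dom D) :=
  [set A | linear A /\ forall y : dom D, adj_dom A (val y) /\ adj A (val y) \in D].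

(* A^+, the restriction of A^* to D.  The default value 0 of insubd is never
   taken when A is in Lplus. *)
Definition dagger A : dom D -> dom D := fun y => insubd 0 (adj A (val y)).

Definition finite_rank A : Prop :=
  exists (n : nat) (e : 'I_n -> dom D),
    forall x, exists c : 'I_n -> R[i], A x = \sum_(i < n) c i *: e i.

Definition finite_rank_ideal : set (dom D -> dom D) :=
  [set A | Lplus A /\ finite_rank A].

Definition star_subalgebra (X : set (dom D -> dom D)) : Prop :=
  [/\ X `<=` Lplus,
      X (fun=> 0),
      forall (c : R[i]) A B, X A -> X B -> X (fun x => c *: A x + B x),
      forall A B, X A -> X B -> X (A \o B) &
      forall A, X A -> X (dagger A)].

Definition standard_operator_algebra (X : set (dom D -> dom D)) : Prop :=
  star_subalgebra X /\ finite_rank_ideal `<=` X.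

Definition unitary W : Prop :=
  [/\ linear W, forall x y, dot (W x) (W y) = dot x y & set_surj setT setT W].

Definition antiunitary W : Prop :=
  [/\ forall (c : R[i]) x y, W (c *: x + y) = Num.conj c *: W x + W y,
      forall x y, dot (W x) (W y) = dot y x & set_surj setT setT W].

Definition continuous_extension A W : Prop :=
  continuous W /\ forall x : dom D, W (val x) = val (A x).

Definition unitary_on A : Prop := exists2 W, continuous_extension A W & unitary W.

Definition antiunitary_on A : Prop :=
  exists2 W, continuous_extension A W & antiunitary W.

End Operators.

(* Main.v *)
Require Import Defs.
From HB Require Import structures.
From mathcomp Require Import all_boot all_order all_algebra.
From mathcomp Require Import ring.
From mathcomp Require Import complex.
From mathcomp Require Import all_classical all_reals all_analysis.
Set Implicit Arguments.
Unset Strict Implicit.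
Unset Printing Implicit Defensive.
Import Order.TTheory GRing.Theory Num.Theory.
Import numFieldNormedType.Exports.
Local Open Scope classical_set_scope.
Local Open Scope ring_scope.

(** Write x ⊗ y for the rank one operator z |-> <z, y> x.  The proof recovers U
    and V from what Phi does to these operators.

    Rank one operators are visible in the triple structure: A has rank at most
    one exactly when A B^+ A is a multiple of A for every B, because for
    A = x ⊗ y the product is <x, B y> A, while testing a nonzero A against
    one suitable rank one B already exhibits A as some a ⊗ b.  Hence Phi maps
    rank one operators to rank one operators, and comparing the scalars gives

      <x', Phi(B) y'> = <x, B y>   whenever Phi(x ⊗ y) = x' ⊗ y'     (iso_form).

    It remains to see how x' and y' depend on x and y.  Fix a unit vector e and
    write Phi(e ⊗ e) = a ⊗ b with unit vectors a and b.  Applying Phi to the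
    polarised triple product of x ⊗ e, e ⊗ e and e ⊗ y (iso_peirce) shows that
    each Phi(x ⊗ e), and each Phi(e ⊗ y), has left factor a or right factor b,
    and also that Phi(x ⊗ e) and Phi(e ⊗ y) cannot share the same factor unless
    x or y lies on the line of e.  So (iso_dichotomy) either every Phi(x ⊗ e)
    has right factor b and every Phi(e ⊗ y) has left factor a, or the other way
    round.

    In the first case the same triple product gives Phi(x ⊗ y) = U x ⊗ V y for
    all x and y.  The displayed formula, applied to rank one B, makes U and V
    isometric; applied to preimages of rank one operators it makes them
    surjective on D; and then it reads Phi(A) V = U A for every A
    (iso_intertwined).  The second case is the first one for A |-> Phi(A^+),
    which satisfies the same triple identity but is conjugate linear.  For this
    reason everything is proved for maps that are semilinear with respect to a
    ring morphism s of the scalars, later the identity or the conjugation.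

    Finally an isometry of D onto D extends to H (semiunitary_extends): by
    completeness there is for each h a vector W h that has the same distance to
    U x as h has to x, for all x in D, and polarisation turns this family of
    distances into <W h, U x> = s <h, x>, from which semilinearity and
    unitarity follow by density. *)

(** * Rank one operators and isometries of pre-Hilbert spaces *)

Section PreHilbert.
Context {C : numClosedFieldType} {E : lmodType C} (ip : {dot E for Num.conj}).
Local Notation "''[' u , v ]" := (ip u v) : ring_scope.
Implicit Types (x y z u v a b : E) (A B : E -> E).

Lemma ipC x y : '[x, y] = '[y, x]^*.
Proof. by rewrite (hermC ip) expr0 mul1r. Qed.

Lemma ipDl x y z : '[x + y, z] = '[x, z] + '[y, z].
Proof. exact: linearDl. Qed.

Lemma ipDr x y z : '[x, y + z] = '[x, y] + '[x, z].
Proof. exact: linearDr. Qed.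

Lemma ipZl c x y : '[c *: x, y] = c * '[x, y].
Proof. exact: linearZl_LR. Qed.

Lemma ipZr c x y : '[x, c *: y] = c^* * '[x, y].
Proof. exact: linearZr_LR. Qed.

Lemma ipBr x y z : '[x, y - z] = '[x, y] - '[x, z].
Proof. exact: linearBr. Qed.

Lemma ipBl x y z : '[x - y, z] = '[x, z] - '[y, z].
Proof. exact: linearBl. Qed.

Lemma ip0l x : '[0, x] = 0. Proof. exact: linear0l. Qed.

Lemma ip0r x : '[x, 0] = 0. Proof. exact: linear0r. Qed.

Lemma ip_eq0 x : ('[x, x] == 0) = (x == 0).
Proof. exact: dnorm_eq0. Qed.

Lemma ip_inj x y : (forall z, '[z, x] = '[z, y]) -> x = y.
Proof.
move=> h; apply/eqP; rewrite -subr_eq0 -ip_eq0.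
by rewrite ipBr h subrr.
Qed.

(** The physicists' |x><y|, that is the rank one operator x ⊗ y. *)
Definition ketbra x y : E -> E := fun z => '[z, y] *: x.

Lemma ketbra_swap c x y : ketbra x (c *: y) = ketbra (c^* *: x) y.
Proof. by apply/funext => z; rewrite /ketbra ipZr scalerA mulrC. Qed.

Lemma ketbra_eq0 x y : ketbra x y = (fun=> 0) -> x = 0 \/ y = 0.
Proof.
move=> /(congr1 (fun f => f y)); rewrite /ketbra => /eqP.
by rewrite scaler_eq0 ip_eq0 => /orP[] /eqP; [right|left].
Qed.

Lemma ketbra_inj2 a x y : a != 0 -> ketbra a x = ketbra a y -> x = y.
Proof.
move=> a0 h; apply: ip_inj => z.
have /eqP := congr1 (fun f => f z) h.
rewrite /ketbra -subr_eq0 -scalerBl scaler_eq0 (negPf a0) orbF subr_eq0.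
by move/eqP.
Qed.

(** The hypothesis is the expansion of (1 - a ⊗ a) (c ⊗ d) (1 - b ⊗ b) = 0.  This
    operator again has rank at most one, so one of its two factors vanishes. *)
Lemma ketbra_complement_eq0 a b c d :
    (forall z, ketbra c d z + ('[c, a] * '[b, d]) *: ketbra a b z =
       '[b, d] *: ketbra c b z + '[c, a] *: ketbra a d z) ->
  c = '[c, a] *: a \/ d = '[d, b] *: b.
Proof.
move=> h; suff : ketbra (c - '[c, a] *: a) (d - '[d, b] *: b) = (fun=> 0).
  by case/ketbra_eq0 => /eqP; rewrite subr_eq0 => /eqP; [left|right].
apply/funext => z; apply/eqP.
rewrite /ketbra ipBr ipZr -ipC scalerBr !scalerBl !scalerA.
rewrite opprB addrA subr_eq0 [X in X == _]addrC addrA.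
apply/eqP; transitivity (ketbra c d z + ('[c, a] * '[b, d]) *: ketbra a b z
  - '[b, d] *: ketbra c b z).
  rewrite /ketbra !scalerA; congr (_ - _); rewrite addrC.
  by congr (_ + _); congr (_ *: _); ring.
rewrite h addrC addKr /ketbra scalerA; congr (_ *: _); ring.
Qed.

End PreHilbert.

(** For s the identity or the conjugation these are the unitary and antiunitary
    operators; semilinearity is a consequence (semiunitary_semilinear). *)
Definition semiunitary {C : numClosedFieldType} {E : lmodType C}
    (ip : {dot E for Num.conj}) (s : C -> C) (U : E -> E) :=
  (forall x y, ip (U x) (U y) = s (ip x y)) /\ set_surj setT setT U.

Section Semiunitary.
Context {C : numClosedFieldType} {E : lmodType C} (ip : {dot E for Num.conj}).
Local Notation "''[' u , v ]" := (ip u v) : ring_scope.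
Context (s : {rmorphism C -> C}).

(** The defect U (c x + y) - s c U x - U y is orthogonal to the range of U, which
    is everything. *)
Lemma semiunitary_semilinear (U : E -> E) :
   (forall c, s c^* = (s c)^*) -> semiunitary ip s U ->
  forall c x y, U (c *: x + y) = s c *: U x + U y.
Proof.
move=> s_conj [isoU surjU] c x y; apply: (@ip_inj _ _ ip) => w.
have [z _ <-] := surjU w I.
by rewrite ipDr ipZr !isoU ipDr ipZr rmorphD rmorphM s_conj.
Qed.

(** The two distances determine the real and the imaginary part of the inner
    product, since s 'i is either 'i or its opposite. *)
Lemma polarization u v x y : (s =1 idfun) \/ (s =1 Num.conj) ->
  '[u, u] = '[x, x] -> '[v, v] = '[y, y] ->
  '[u - v, u - v] = '[x - y, x - y] ->
  '[u - s 'i *: v, u - s 'i *: v] = '[x - 'i *: y, x - 'i *: y] ->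
  '[u, v] = s '[x, y].
Proof.
have i0 : 'i != 0 :> C by exact: neq0Ci.
have two0 : 2 != 0 :> C by rewrite pnatr_eq0.
have ii : 'i * 'i = -1 :> C by rewrite -expr2 sqrCi.
rewrite !(ipBl, ipBr, ipZl, ipZr) => sE -> ->.
set p := '[u, v]; set q := '[v, u]; set r := '[x, y]; set t := '[y, x].
set m := '[x, x]; set n := '[y, y]; move=> /eqP; rewrite -subr_eq0 => /eqP h1.
have {}h1 : p + q = r + t.
  by apply/eqP; rewrite -subr_eq0 -oppr_eq0 -h1; apply/eqP; ring.
have tE : t = r^* by rewrite /t ipC.
case: sE => sE; rewrite !sE /= ?conjCi => /eqP; rewrite -subr_eq0 => /eqP h2.
  have {}h2 : 'i * (p - q - r + t) = 0 by rewrite -h2; ring.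
  apply: (mulfI two0); apply/eqP; rewrite -subr_eq0.
  move/eqP: h2; rewrite mulf_eq0 (negPf i0) /= => /eqP h2.
  rewrite -h2; apply/eqP.
  by rewrite (_ : q = r + t - p); [ring|rewrite -h1; ring].
have {}h2 : 'i * (p - q + r - t) = 0.
  rewrite -[RHS]oppr0 -h2 ?rmorphN /= ?conjCi; ring: ii.
apply: (mulfI two0); apply/eqP; rewrite -subr_eq0 -tE.
move/eqP: h2; rewrite mulf_eq0 (negPf i0) /= => /eqP h2.
rewrite -h2; apply/eqP.
by rewrite (_ : q = r + t - p); [ring|rewrite -h1; ring].
Qed.

Lemma semiunitary_inverse (V : E -> E) :
   involutive s -> semiunitary ip s V ->
  exists2 G, semiunitary ip s G & cancel G V /\ cancel V G.
Proof.
move=> sK [isoV surjV].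
have /choice[G VG] : forall y, exists x, V x = y.
  by move=> y; have [x _ <-] := surjV y I; exists x.
have GV : cancel V G.
  move=> x; apply: (@ip_inj _ _ ip) => z; apply: (fmorph_inj s).
  by rewrite -!isoV VG.
exists G => //; split=> [x y|x _]; first by rewrite -[LHS]sK -isoV !VG.
by exists (V x).
Qed.

End Semiunitary.

(** * Star algebras of operators containing all rank one operators *)

Section StarAlgebra.
Context {C : numClosedFieldType} {E : lmodType C} (ip : {dot E for Num.conj}).
Local Notation "''[' u , v ]" := (ip u v) : ring_scope.
Implicit Types (x y z u v a b : E) (A B : E -> E).

(** The algebraic content of a standard operator algebra, free of the ambient
    Hilbert space.  Having an adjoint makes every operator in X linear (std_add,
    std_scale), and std_adj determines dag on X (dag_unique). *)
Record std_algebra (dag : (E -> E) -> (E -> E)) (X : set (E -> E)) : Prop := {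
  std_adj : forall A, X A -> forall x y, '[A x, y] = '[x, dag A y];
  std_comb : forall c A B, X A -> X B -> X (fun x => c *: A x + B x);
  std_comp : forall A B, X A -> X B -> X (A \o B);
  std_dag : forall A, X A -> X (dag A);
  std_ketbra : forall x y, X (ketbra ip x y) }.

Context (dag : (E -> E) -> (E -> E)) (X : set (E -> E)).
Context (Xstd : std_algebra dag X).

Lemma std_adjr A x y : X A -> '[x, A y] = '[dag A x, y].
Proof. by move=> XA; rewrite ipC (std_adj Xstd XA) -ipC. Qed.

Lemma dagK A : X A -> dag (dag A) = A.
Proof.
move=> XA; apply/funext => y; apply: (@ip_inj _ _ ip) => x.
by rewrite -(std_adj Xstd (std_dag Xstd XA)) -std_adjr.
Qed.

Lemma dag_unique A B : X A -> (forall x y, '[A x, y] = '[x, B y]) -> dag A = B.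
Proof.
move=> XA h; apply/funext => y; apply: (@ip_inj _ _ ip) => x.
by rewrite -(std_adj Xstd XA).
Qed.

Lemma dag_ketbra x y : dag (ketbra ip x y) = ketbra ip y x.
Proof.
apply: dag_unique; first exact: (std_ketbra Xstd).
by move=> u v; rewrite /ketbra ipZl ipZr -ipC mulrC.
Qed.

Lemma dag_comb c A B : X A -> X B ->
  dag (fun x => c *: A x + B x) = (fun x => c^* *: dag A x + dag B x).
Proof.
move=> XA XB; apply: dag_unique; first exact: (std_comb Xstd).
move=> x y; rewrite ipDl ipDr ipZl ipZr conjCK.
by rewrite (std_adj Xstd XA) (std_adj Xstd XB).
Qed.

Lemma dag_comp A B : X A -> X B -> dag (A \o B) = dag B \o dag A.
Proof.
move=> XA XB; apply: dag_unique; first exact: (std_comp Xstd).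
by move=> x y /=; rewrite (std_adj Xstd XA) (std_adj Xstd XB).
Qed.

Lemma std_add A x y : X A -> A (x + y) = A x + A y.
Proof.
by move=> XA; apply: (@ip_inj _ _ ip) => z; rewrite ipDr !(std_adjr _ _ XA) ipDr.
Qed.

Lemma std_scale A c x : X A -> A (c *: x) = c *: A x.
Proof.
by move=> XA; apply: (@ip_inj _ _ ip) => z; rewrite ipZr !(std_adjr _ _ XA) ipZr.
Qed.

Lemma std_zero : X (fun=> 0).
Proof.
have -> : (fun=> 0) = ketbra ip 0 0 by apply/funext => z; rewrite /ketbra scaler0.
exact: (std_ketbra Xstd).
Qed.

(** If v := A u is nonzero, B = v ⊗ u gives A B^+ A = v ⊗ A^+ v.  The scalar c
    with A B^+ A = c A is nonzero because <A u, A u> is, and so A is itself of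
    this shape. *)
Lemma rank_one_of_triple A : X A ->
    (forall B, X B -> exists c, forall z, A (dag B (A z)) = c *: A z) ->
  exists a b, A = ketbra ip a b.
Proof.
move=> XA h; have [A0|] := pselect (forall u, A u = 0).
  by exists 0, 0; apply/funext => z; rewrite A0 /ketbra scaler0.
move=> /existsNP[u /eqP Au0]; set v := A u.
have [c hc] := h _ (std_ketbra Xstd v u).
have {}hc z : '[z, dag A v] *: v = c *: A z.
  by rewrite -hc dag_ketbra /ketbra (std_scale _ _ XA) -(std_adj Xstd XA).
have c0 : c != 0.
  apply/eqP => c0; have /eqP := hc u; rewrite c0 scale0r -(std_adj Xstd XA).
  by rewrite scaler_eq0 ip_eq0 (negPf Au0).
exists (c^-1 *: v), (dag A v); apply/funext => z.
by rewrite /ketbra scalerA mulrC -scalerA hc scalerA mulVf // scale1r.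
Qed.

End StarAlgebra.

(** * Semilinear triple isomorphisms *)

Section TripleIso.
Context {C : numClosedFieldType} {E : lmodType C} (ip : {dot E for Num.conj}).
Local Notation "''[' u , v ]" := (ip u v) : ring_scope.
Local Notation "x ⊗ y" := (ketbra ip x y) (at level 45).
Implicit Types (x y z u v a b : E) (A B : E -> E).
Context (dag : (E -> E) -> (E -> E)).

(** The involution makes A |-> Phi(A^+) conjugate linear when Phi is linear; the
    scalar map s lets one argument serve both. *)
Record triple_iso (s : C -> C) (X Y : set (E -> E))
    (Phi : (E -> E) -> (E -> E)) : Prop := {
  iso_bij : set_bij X Y Phi;
  iso_comb : forall c A B, X A -> X B ->
    Phi (fun x => c *: A x + B x) = (fun x => s c *: Phi A x + Phi B x);
  iso_triple : forall A B, X A -> X B ->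
    Phi (A \o dag B \o A) = Phi A \o dag (Phi B) \o Phi A }.

Context (s : {rmorphism C -> C}) (s_conj : forall c, s c^* = (s c)^*).
Context (X Y : set (E -> E)) (Xstd : std_algebra ip dag X)
  (Ystd : std_algebra ip dag Y).
Context (Phi : (E -> E) -> (E -> E)) (PhiP : triple_iso s X Y Phi).

Lemma iso_maps A : X A -> Y (Phi A).
Proof. by case: (iso_bij PhiP) => f _ _; exact: f. Qed.
Hint Resolve iso_maps : core.

Lemma iso_inj A B : X A -> X B -> Phi A = Phi B -> A = B.
Proof. by case: (iso_bij PhiP) => _ f _ XA XB; apply: f; rewrite inE. Qed.

Lemma iso_surj B : Y B -> exists2 A, X A & Phi A = B.
Proof. by case: (iso_bij PhiP) => _ _ f YB; have [A] := f _ YB; exists A. Qed.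

Let Xkb x y : X (x ⊗ y) := std_ketbra Xstd x y.
Let Ykb x y : Y (x ⊗ y) := std_ketbra Ystd x y.
Hint Resolve Xkb Ykb : core.

Lemma iso_zero : Phi (fun=> 0) = (fun=> 0).
Proof.
have := @iso_comb _ _ _ _ PhiP (-1) _ _ (Xkb 0 0) (Xkb 0 0).
have -> : (fun x => -1 *: (0 ⊗ 0) x + (0 ⊗ 0) x) = (fun=> 0).
  by apply/funext => z; rewrite /ketbra !scaler0 addr0.
by move=> ->; apply/funext => z; rewrite rmorphN1 scaleN1r addNr.
Qed.

Lemma iso_add A B : X A -> X B ->
  Phi (fun x => A x + B x) = (fun x => Phi A x + Phi B x).
Proof.
move=> XA XB; have := @iso_comb _ _ _ _ PhiP 1 _ _ XA XB; rewrite rmorph1.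
have -> : (fun x => 1 *: A x + B x) = (fun x => A x + B x).
  by apply/funext => z; rewrite scale1r.
by move->; apply/funext => z; rewrite scale1r.
Qed.

Lemma iso_scale c A : X A -> Phi (fun x => c *: A x) = (fun x => s c *: Phi A x).
Proof.
move=> XA; have := @iso_comb _ _ _ _ PhiP c _ _ XA (std_zero Xstd).
have -> : (fun x => c *: A x + 0) = (fun x => c *: A x).
  by apply/funext => z; rewrite addr0.
by move->; apply/funext => z; rewrite iso_zero addr0.
Qed.

Let XD A B : X A -> X B -> X (fun x => A x + B x).
Proof.
move=> XA XB; have := std_comb Xstd 1 XA XB.
have -> // : (fun x => 1 *: A x + B x) = (fun x => A x + B x).
by apply/funext => z; rewrite scale1r.
Qed.

(** Replace A by A + D in the triple identity and cancel the pure terms. *)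
Lemma iso_polarized A B D : X A -> X B -> X D ->
  Phi (fun z => A (dag B (D z)) + D (dag B (A z))) =
  (fun z => Phi A (dag (Phi B) (Phi D z)) + Phi D (dag (Phi B) (Phi A z))).
Proof.
have quad (p q r t : E) : (p + q) + (r + t) = (p + t) + (q + r).
  by rewrite -!addrA; congr (_ + _); rewrite addrA addrC.
move=> XA XB XD'; have XdB := std_dag Xstd XB.
have X3 S T : X S -> X T -> X (fun z => S (dag B (T z))).
  by move=> XS XT; exact: (std_comp Xstd (std_comp Xstd XS XdB) XT).
have := iso_triple PhiP (XD XA XD') XB.
have -> : (fun x => A x + D x) \o dag B \o (fun x => A x + D x) =
   (fun z => (fun w => A (dag B (A w)) + D (dag B (D w))) z
            + (fun w => A (dag B (D w)) + D (dag B (A w))) z).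
  apply/funext => z /=; rewrite (std_add Xstd _ _ XdB).
  rewrite (std_add Xstd _ _ XA) (std_add Xstd _ _ XD').
  exact: quad.
rewrite iso_add; [|by apply: XD; apply: X3..].
rewrite iso_add; [|by apply: X3..].
have h S : X S -> Phi (fun z => S (dag B (S z))) =
    (fun z => Phi S (dag (Phi B) (Phi S z)))
  by move=> XS; exact: (iso_triple PhiP XS XB).
rewrite !h // (iso_add XA XD') => H; apply/funext => z.
move: (congr1 (fun f => f z) H) => /=.
have YA := iso_maps XA; have YD := iso_maps XD'.
have YdB := std_dag Ystd (iso_maps XB).
rewrite (std_add Ystd _ _ YdB) (std_add Ystd _ _ YA) (std_add Ystd _ _ YD).
by rewrite quad => /addrI.
Qed.

(** x ⊗ y satisfies the criterion of rank_one_of_triple and, Phi being onto, so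
    does its image. *)
Lemma iso_rank_one x y : exists a b, Phi (x ⊗ y) = a ⊗ b.
Proof.
apply: (rank_one_of_triple Ystd); first exact: iso_maps.
move=> B' /iso_surj[B XB <-]; exists (s '[dag B x, y]) => z.
rewrite -[LHS](congr1 (fun f => f z) (iso_triple PhiP (Xkb x y) XB)).
have -> : x ⊗ y \o dag B \o x ⊗ y = (fun z => '[dag B x, y] *: (x ⊗ y) z).
  apply/funext => w; rewrite /= /ketbra (std_scale Xstd _ _ (std_dag Xstd XB)).
  by rewrite ipZl !scalerA mulrC.
by rewrite iso_scale.
Qed.

(** Both sides are the scalar by which the triple product A B^+ A, for
    A = x ⊗ y, differs from A, before and after applying Phi.  When A vanishes
    this scalar is not determined by the product, but then injectivity of Phi
    makes both sides zero. *)
Lemma iso_form x y x' y' B : Phi (x ⊗ y) = x' ⊗ y' -> X B ->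
  '[x', Phi B y'] = s '[x, B y].
Proof.
move=> h XB; have YB := iso_maps XB.
have E1 : x ⊗ y \o dag B \o x ⊗ y = (fun z => '[x, B y] *: (x ⊗ y) z).
  apply/funext => w; rewrite /= /ketbra (std_scale Xstd _ _ (std_dag Xstd XB)).
  by rewrite ipZl !scalerA mulrC (std_adjr Xstd _ _ XB).
have := iso_triple PhiP (Xkb x y) XB; rewrite E1 iso_scale // h => H.
have {}H z : s '[x, B y] *: (x' ⊗ y') z = '[x', Phi B y'] *: (x' ⊗ y') z.
  rewrite (congr1 (fun f => f z) H) /= /ketbra.
  rewrite (std_scale Ystd _ _ (std_dag Ystd YB)).
  by rewrite ipZl !scalerA mulrC (std_adjr Ystd _ _ YB).
have [xy0|] := pselect (x' ⊗ y' = fun=> 0); last first.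
  move=> xy0; apply/eqP; rewrite eq_sym -subr_eq0; apply/negPn/negP => ne0.
  apply: xy0; apply/funext => z; have /eqP := H z.
  by rewrite -subr_eq0 -scalerBl scaler_eq0 (negPf ne0) => /eqP.
have : x ⊗ y = fun=> 0.
  by apply: iso_inj => //; [exact: std_zero Xstd | rewrite h xy0 iso_zero].
have lin0 A : X A -> A 0 = 0.
  by move=> XA; rewrite -[X in A X](scale0r 0) (std_scale Xstd _ _ XA) scale0r.
have Phi0 : Phi B 0 = 0.
  by rewrite -[X in Phi B X](scale0r 0) (std_scale Ystd _ _ YB) scale0r.
have -> : '[x', Phi B y'] = 0.
  by case: (ketbra_eq0 xy0) => ->; rewrite ?ip0l // Phi0 ip0r.
by case/ketbra_eq0 => ->; rewrite ?ip0l ?lin0 ?ip0r ?rmorph0.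
Qed.

(** Phi preserves the Hilbert-Schmidt inner product of rank one operators. *)
Lemma iso_gram x y x' y' u v u' v' :
    Phi (x ⊗ y) = x' ⊗ y' -> Phi (u ⊗ v) = u' ⊗ v' ->
  '[x', u'] * '[v', y'] = s ('[x, u] * '[v, y]).
Proof.
move=> h1 h2; have := iso_form h1 (Xkb u v); rewrite h2 /ketbra !ipZr.
by rewrite -!ipC mulrC => ->; rewrite mulrC.
Qed.

Lemma iso_ketbra_scale c d x y x' y' : Phi (x ⊗ y) = x' ⊗ y' ->
  Phi ((c *: x) ⊗ (d *: y)) = (s c *: x') ⊗ (s d *: y').
Proof.
move=> h; have -> : (c *: x) ⊗ (d *: y) = (fun z => (c * d^* ) *: (x ⊗ y) z).
  by apply/funext => z; rewrite /ketbra ipZr !scalerA; congr (_ *: _); ring.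
rewrite iso_scale // h; apply/funext => z.
by rewrite /ketbra ipZr !scalerA rmorphM s_conj; congr (_ *: _); ring.
Qed.

Lemma iso_unit e : '[e, e] = 1 ->
  exists a b, [/\ '[a, a] = 1, '[b, b] = 1 & Phi (e ⊗ e) = a ⊗ b].
Proof.
move=> e1; have [a [b h]] := iso_rank_one e e.
have := iso_gram h h; rewrite e1 mulr1 rmorph1 => ab1.
set r := sqrtC '[b, b].
have r_ge0 : 0 <= r by rewrite sqrtC_ge0 dnorm_ge0.
have rr : r ^+ 2 = '[b, b] by rewrite sqrtCK.
have r0 : r != 0.
  apply/eqP => r0; move: ab1; rewrite -rr r0 expr0n mulr0 => /eqP.
  by rewrite eq_sym oner_eq0.
have rC : r^* = r by apply/CrealP/ger0_real.
have rVC : (r^-1)^* = r^-1 by rewrite fmorphV /= rC.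
(* The norms of a and b have product 1; r is the norm of b. *)
exists (r *: a), (r^-1 *: b); split.
- by rewrite ipZl ipZr rC -ab1 -rr; ring.
- by rewrite ipZl ipZr rVC -rr; field.
- rewrite h; apply/funext => z; rewrite /ketbra ipZr rVC scalerA.
  by congr (_ *: _); field.
Qed.

Section Peirce.
Context (e a b : E) (e1 : '[e, e] = 1) (a1 : '[a, a] = 1) (b1 : '[b, b] = 1).
Context (Phie : Phi (e ⊗ e) = a ⊗ b).

Lemma iso_column_coef x c d : Phi (x ⊗ e) = c ⊗ d ->
  '[c, a] * '[b, d] = s '[x, e].
Proof. by move=> /iso_gram /(_ Phie); rewrite e1 mulr1. Qed.

Lemma iso_row_coef y p q : Phi (e ⊗ y) = p ⊗ q ->
  '[p, a] * '[b, q] = s '[e, y].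
Proof. by move=> /iso_gram /(_ Phie); rewrite e1 mul1r. Qed.

(** The image under Phi of the triple product of x ⊗ e, e ⊗ e and e ⊗ y.  That
    product equals x ⊗ y up to a multiple of e ⊗ e, so Phi(x ⊗ y) is known as
    soon as the images of the column x ⊗ e and of the row e ⊗ y are. *)
Lemma iso_peirce x y c d p q : Phi (x ⊗ e) = c ⊗ d -> Phi (e ⊗ y) = p ⊗ q ->
  forall z, Phi (x ⊗ y) z + s ('[x, e] * '[e, y]) *: (a ⊗ b) z =
    ('[p, a] * '[b, d]) *: (c ⊗ q) z + ('[c, a] * '[b, q]) *: (p ⊗ d) z.
Proof.
move=> hc hp z.
have := iso_polarized (Xkb x e) (Xkb e e) (Xkb e y).
rewrite hc hp Phie (dag_ketbra Xstd) (dag_ketbra Ystd).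
have -> : (fun z => (x ⊗ e) ((e ⊗ e) ((e ⊗ y) z))
                    + (e ⊗ y) ((e ⊗ e) ((x ⊗ e) z))) =
          (fun z => ('[x, e] * '[e, y]) *: (e ⊗ e) z + (x ⊗ y) z).
  apply/funext => w; rewrite /ketbra !ipZl !scalerA e1 addrC.
  by congr (_ *: _ + _ *: _); ring.
rewrite (iso_comb PhiP) // Phie => /(congr1 (fun f => f z)).
rewrite addrC => ->; rewrite /ketbra !ipZl !scalerA.
by congr (_ *: _ + _ *: _); ring.
Qed.

(** With y = e, iso_peirce is the hypothesis of ketbra_complement_eq0 for
    Phi(x ⊗ e) relative to a and b. *)
Lemma iso_column_factor x : (exists x', Phi (x ⊗ e) = x' ⊗ b) \/
  (exists x', Phi (x ⊗ e) = a ⊗ x').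
Proof.
have [c [d h]] := iso_rank_one x e.
have : c = '[c, a] *: a \/ d = '[d, b] *: b.
  apply: ketbra_complement_eq0 => z; have := iso_peirce h Phie z.
  by rewrite h e1 a1 b1 !mulr1 mul1r (iso_column_coef h).
by case=> Ec; [right; exists ('[c, a]^* *: d)|left; exists ('[d, b]^* *: c)];
  rewrite h {1}Ec ketbra_swap ?conjCK.
Qed.

Lemma iso_row_factor y : (exists y', Phi (e ⊗ y) = y' ⊗ b) \/
  (exists y', Phi (e ⊗ y) = a ⊗ y').
Proof.
have [p [q h]] := iso_rank_one e y.
have : p = '[p, a] *: a \/ q = '[q, b] *: b.
  apply: ketbra_complement_eq0 => z; have := iso_peirce Phie h z.
  by rewrite h e1 a1 b1 !mulr1 !mul1r (iso_row_coef h) [in RHS]addrC.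
by case=> Ec; [right; exists ('[p, a]^* *: q)|left; exists ('[q, b]^* *: p)];
  rewrite h {1}Ec ketbra_swap ?conjCK.
Qed.

(** If the images share a factor, iso_peirce expresses Phi(x ⊗ y) through
    Phi(x ⊗ e), Phi(e ⊗ y) and Phi(e ⊗ e).  By injectivity the same relation
    holds before applying Phi, and there ketbra_complement_eq0, now relative to
    e and e, says that x or y is a multiple of e. *)
Lemma iso_shared_factor x y c d p q :
    Phi (x ⊗ e) = c ⊗ d -> Phi (e ⊗ y) = p ⊗ q ->
    (d = b /\ q = b) \/ (c = a /\ p = a) ->
  x = '[x, e] *: e \/ y = '[y, e] *: e.
Proof.
move=> hc hp side; have hl := iso_column_coef hc; have hr := iso_row_coef hp.
apply: ketbra_complement_eq0 => z.
pose L z := ('[x, e] * '[e, y]) *: (e ⊗ e) z + (x ⊗ y) z.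
pose Q z := '[e, y] *: (x ⊗ e) z + '[x, e] *: (e ⊗ y) z.
have XQ : X (fun z => '[x, e] *: (e ⊗ y) z).
  have := std_comb Xstd '[x, e] (Xkb e y) (std_zero Xstd).
  by congr X; apply/funext => w; rewrite addr0.
have : L = Q.
  apply: iso_inj; [exact: std_comb Xstd _ _ _ _ _|exact: (std_comb Xstd)|].
  rewrite !(iso_comb PhiP) // iso_scale // Phie hc hp; apply/funext => w.
  have := iso_peirce hc hp w; rewrite addrC => ->.
  case: side => -[E1 E2]; rewrite {}E1 {}E2 ?a1 ?b1 ?mulr1 ?mul1r in hl hr *.
    by rewrite -hl -hr.
  by rewrite -hl -hr addrC.
by move=> /(congr1 (fun f => f z)); rewrite addrC.
Qed.

Lemma iso_column_line x : x = '[x, e] *: e ->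
  Phi (x ⊗ e) = a ⊗ ((s '[x, e])^* *: b).
Proof.
move=> {1}->; rewrite -[X in _ ⊗ X](scale1r e) (iso_ketbra_scale _ _ Phie).
by apply/funext => z; rewrite /ketbra rmorph1 scale1r ipZr conjCK scalerA mulrC.
Qed.

Lemma iso_row_line y : y = '[y, e] *: e ->
  Phi (e ⊗ y) = (s '[y, e])^* *: a ⊗ b.
Proof.
move=> {1}->; rewrite -[X in X ⊗ _](scale1r e) (iso_ketbra_scale _ _ Phie).
by apply/funext => z; rewrite /ketbra rmorph1 scale1r ipZr scalerA mulrC.
Qed.

(** If the line of e is the whole space, all images are multiples of a ⊗ b.
    Otherwise pick f off that line: the factor of Phi(f ⊗ e) forces, by
    iso_shared_factor, the opposite factor on every row, and then the row of f
    forces the factor on every column. *)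
Lemma iso_dichotomy :
  ((forall x, exists x', Phi (x ⊗ e) = x' ⊗ b) /\
   (forall y, exists y', Phi (e ⊗ y) = a ⊗ y')) \/
  ((forall x, exists x', Phi (x ⊗ e) = a ⊗ x') /\
   (forall y, exists y', Phi (e ⊗ y) = y' ⊗ b)).
Proof.
pose l x := x = '[x, e] *: e.
have line x : l x -> [/\ exists x', Phi (x ⊗ e) = x' ⊗ b,
    exists x', Phi (x ⊗ e) = a ⊗ x', exists y', Phi (e ⊗ x) = a ⊗ y' &
    exists y', Phi (e ⊗ x) = y' ⊗ b].
  move=> lx; rewrite (iso_column_line lx) (iso_row_line lx).
  split; try by eexists.
  - by eexists; rewrite ketbra_swap.
  - by eexists; rewrite -ketbra_swap.
have LL x y : (exists x', Phi (x ⊗ e) = x' ⊗ b) ->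
    (exists y', Phi (e ⊗ y) = y' ⊗ b) -> l x \/ l y.
  by move=> [x' h1] [y' h2]; apply: (iso_shared_factor h1 h2); left.
have RR x y : (exists x', Phi (x ⊗ e) = a ⊗ x') ->
    (exists y', Phi (e ⊗ y) = a ⊗ y') -> l x \/ l y.
  by move=> [x' h1] [y' h2]; apply: (iso_shared_factor h1 h2); right.
have [all_l|/existsNP[f nlf]] := pselect (forall x, l x).
  by left; split=> x; case: (line x (all_l x)).
have [Lf|Rf] := iso_column_factor f; [left|right].
- have Ry y : exists y', Phi (e ⊗ y) = a ⊗ y'.
    by have [/(LL _ _ Lf)[//|/line[]]|] := iso_row_factor y.
  by split=> // x; have [//|/RR/(_ (Ry f))[/line[]|]] := iso_column_factor x.
- have Ly y : exists y', Phi (e ⊗ y) = y' ⊗ b.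
    by have [//|/(RR _ _ Rf)[//|/line[]]] := iso_row_factor y.
  by split=> // x; have [/LL/(_ (Ly f))[/line[]|]|//] := iso_column_factor x.
Qed.

(** The case Phi(x ⊗ y) = U x ⊗ V y.  Isometry of U and V comes from iso_gram,
    surjectivity from the preimages T of w ⊗ b and a ⊗ w: by iso_form such a T
    has the same matrix coefficients as T e ⊗ e, respectively e ⊗ T^+ e. *)
Lemma iso_intertwined : (forall x, exists x', Phi (x ⊗ e) = x' ⊗ b) ->
    (forall y, exists y', Phi (e ⊗ y) = a ⊗ y') ->
  exists U V, [/\ semiunitary ip s U, semiunitary ip s V &
    forall A, X A -> Phi A \o V = U \o A].
Proof.
move=> /choice[U hU] /choice[V hV].
have isoU x u : '[U x, U u] = s '[x, u].
  by have := iso_gram (hU x) (hU u); rewrite b1 e1 !mulr1.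
have isoV y v : '[V y, V v] = s '[y, v].
  by have := iso_gram (hV v) (hV y); rewrite a1 e1 !mul1r.
have Ue : U e = a.
  have /(congr1 (fun f => f b)) := hU e.
  by rewrite Phie /ketbra b1 !scale1r.
have a0 : a != 0 by rewrite -(ip_eq0 ip) a1 oner_eq0.
have Ve : V e = b by apply: (ketbra_inj2 (ip := ip) a0); rewrite -hV.
have UV x y : Phi (x ⊗ y) = U x ⊗ V y.
  apply/funext => z; have := iso_peirce (hU x) (hV y) z.
  rewrite rmorphM -(iso_column_coef (hU x)) -(iso_row_coef (hV y)) a1 b1.
  rewrite mulr1 !mul1r.
  by move/addIr; rewrite scale1r.
have formUV x y B : X B -> '[U x, Phi B (V y)] = s '[x, B y].
  exact: iso_form (UV x y).
have surjU w : exists x, U x = w.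
  have [T XT PhiT] := iso_surj (Ykb w b); exists (T e).
  have /(congr1 (fun f => f b)) : U (T e) ⊗ b = w ⊗ b.
    (* T = T e ⊗ e, and Phi(T e ⊗ e) has left factor U (T e). *)
    rewrite -hU -PhiT; congr Phi; apply/funext => y; apply: (@ip_inj _ _ ip) => x.
    apply: (fmorph_inj s); rewrite -(formUV x y T XT) PhiT /ketbra !ipZr rmorphM.
    rewrite -(formUV x e T XT) PhiT /ketbra ipZr Ve b1 conjC1 mul1r.
    by rewrite s_conj -isoV Ve.
  by rewrite /ketbra b1 !scale1r.
have surjV w : exists y, V y = w.
  have [T XT PhiT] := iso_surj (Ykb a w); exists (dag T e).
  (* T = e ⊗ T^+ e, and Phi(e ⊗ T^+ e) has right factor V (T^+ e). *)
  apply: (ketbra_inj2 (ip := ip) a0); rewrite -hV -PhiT; congr Phi.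
  apply/funext => y; apply: (@ip_inj _ _ ip) => x.
  apply: (fmorph_inj s); rewrite /ketbra -(std_adj Xstd XT) ipZr -ipC rmorphM.
  rewrite -(formUV x y T XT) -(formUV e y T XT) PhiT /ketbra !ipZr Ue a1 mulr1.
  by rewrite -isoU Ue.
exists U, V; split.
- by split=> // w _; have [x <-] := surjU w; exists x.
- by split=> // w _; have [x <-] := surjV w; exists x.
- move=> A XA; apply/funext => y; apply: (@ip_inj _ _ ip) => z /=.
  by have [x <-] := surjU z; rewrite formUV // isoU.
Qed.

End Peirce.

End TripleIso.

(** * Classification on the pre-Hilbert space *)

Section Classification.
Context {C : numClosedFieldType} {E : lmodType C} (ip : {dot E for Num.conj}).
Local Notation "''[' u , v ]" := (ip u v) : ring_scope.
Local Notation "x ⊗ y" := (ketbra ip x y) (at level 45).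
Implicit Types (x y z u v a b : E) (A B : E -> E).
Context (dag : (E -> E) -> (E -> E)).
Context (X Y : set (E -> E)) (Xstd : std_algebra ip dag X)
  (Ystd : std_algebra ip dag Y).
Context (Phi : (E -> E) -> (E -> E)) (PhiP : triple_iso dag idfun X Y Phi).

Lemma triple_iso_comp_dag : triple_iso dag Num.conj X Y (Phi \o dag).
Proof.
split.
- case: (iso_bij PhiP) => f i g; split.
  + by move=> A XA; apply: f; exact: std_dag Xstd _ XA.
  + move=> A B; rewrite !inE => XA XB /= /i; rewrite !inE => eqAB.
    rewrite -(dagK Xstd XA) -(dagK Xstd XB) eqAB //; exact: std_dag Xstd _ _.
  + move=> B /g[A XA <-]; exists (dag A); first exact: std_dag Xstd _ XA.
    by rewrite /= (dagK Xstd XA).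
- move=> c A B XA XB /=; rewrite (dag_comb Xstd) // (iso_comb PhiP) //;
  exact: std_dag Xstd _ _.
- move=> A B XA XB; have XdA := std_dag Xstd XA; have XdB := std_dag Xstd XB.
  have XAB := std_comp Xstd XA XdB.
  rewrite -[RHS](iso_triple PhiP XdA XdB) /=; congr Phi.
  by rewrite (dag_comp Xstd XAB XA) (dag_comp Xstd XA XdB).
Qed.

(** In the second case of iso_dichotomy the roles of rows and columns are
    exchanged by the involution, so iso_intertwined applies to A |-> Phi(A^+).
    On the zero space there is no unit vector, and all maps coincide. *)
Theorem triple_iso_classification :
  (exists U V, [/\ semiunitary ip idfun U, semiunitary ip idfun V &
    forall A, X A -> Phi A \o V = U \o A]) \/
  (exists U V, [/\ semiunitary ip Num.conj U, semiunitary ip Num.conj V &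
    forall A, X A -> Phi A \o V = U \o dag A]).
Proof.
have [E0|/existsNP[w /eqP w0]] := pselect (forall x : E, x = 0).
  left; exists id, id; split=> [||A _].
  - by split=> // x _; exists x.
  - by split=> // x _; exists x.
  - by apply/funext => x; rewrite [LHS]E0 [RHS]E0.
pose r := sqrtC '[w, w]; have r0 : r != 0 by rewrite sqrtC_eq0 ip_eq0.
have rC : r^* = r by apply/CrealP/ger0_real; rewrite sqrtC_ge0 dnorm_ge0.
pose e := r^-1 *: w; have e1 : '[e, e] = 1.
  have rr : r ^+ 2 = '[w, w] by rewrite sqrtCK.
  by rewrite ipZl ipZr fmorphV /= rC -rr; field.
have [a [b [a1 b1 Phie]]] := iso_unit (s := idfun) Xstd Ystd PhiP e1.
have [[hl hr]|[hl hr]] :=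
    iso_dichotomy (s := idfun) (fun=> erefl) Xstd Ystd PhiP e1 a1 b1 Phie.
  left; exact: (iso_intertwined (s := idfun) (fun=> erefl) Xstd Ystd PhiP
    e1 a1 b1 Phie).
right; have Psi_kb x y : (Phi \o dag) (x ⊗ y) = Phi (y ⊗ x).
  by rewrite /= (dag_ketbra Xstd).
have [|x|y|U [V [hU hV hUV]]] := iso_intertwined (s := Num.conj) (fun=> erefl)
    Xstd Ystd triple_iso_comp_dag e1 a1 b1.
- by rewrite Psi_kb.
- by rewrite Psi_kb; exact: hr.
- by rewrite Psi_kb; exact: hl.
exists U, V; split=> // A XA.
by rewrite -hUV /= ?(dagK Xstd XA) //; exact: std_dag Xstd _ XA.
Qed.

End Classification.

(** * Extension of isometries from a dense subspace *)

Section Density.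
Context {K : numFieldType} {H : completeNormedModType K} (D : submodClosed H).
Context (D_dense : dense [set` D]).
Implicit Types (h z : H) (x y : dom D).

Lemma dense_approx h (e : K) : 0 < e -> exists x : dom D, `|h - val x| < e.
Proof.
move=> e0; have [|k [hk Dk]] := D_dense _ (ball_open h e).
  by exists h; exact: ballxx.
by exists (Dom Dk); move: hk; rewrite -ball_normE.
Qed.

Lemma small_norm_eq0 (V : normedZmodType K) (v : V) :
  (forall e : K, 0 < e -> `|v| < e) -> v = 0.
Proof.
move=> small; apply/eqP/negPn/negP; rewrite -normr_gt0 => v0.
by have := small _ v0; rewrite ltxx.
Qed.

(** The images under f of the traces on D of the neighbourhoods of h form a
    Cauchy filter; z is its limit.  The conclusion is purely metric, so that it
    covers linear and conjugate linear maps alike, and determines z when the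
    range of f is dense. *)
Lemma isometry_extend (f : dom D -> H) :
    (forall x y, `|f x - f y| = `|val x - val y|) ->
  forall h, exists z, forall x, `|z - f x| = `|h - val x|.
Proof.
move=> isof h.
pose F : set_system H := filter_from (nbhs h) (fun A => f @` (val @^-1` A)).
have FF : ProperFilter F.
  apply: filter_from_proper; first apply: filter_from_filter.
  - by exists setT; exact: filterT.
  - move=> A B hA hB; exists (A `&` B); first exact: filterI.
    by move=> _ [x [Ax Bx] <-]; split; exists x.
  - move=> A /nbhs_ballP[e /= e0 eA]; have [x hx] := dense_approx h e0.
    by exists (f x), x => //; apply: eA; rewrite -ball_normE.
have Fball e : 0 < e -> F (f @` [set x | `|h - val x| < e]).
  move=> e0; exists (ball h e); first exact: nbhsx_ballx.
  by rewrite -ball_normE.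
have /cauchy_exP/cauchy_cvg Fcvg : cauchy_ex F.
  move=> e e0; have e20 : 0 < e / 2 by rewrite divr_gt0.
  have [x0 hx0] := dense_approx h e20; exists (f x0).
  apply: filterS (Fball _ e20) => _ [x /= hx <-].
  rewrite -ball_normE /= isof (splitr e) (le_lt_trans _ (ltrD hx0 hx)) //.
  by rewrite [`|h - val x0|]distrC; exact: ler_distD.
exists (lim F) => x; apply/eqP; rewrite -subr_eq0; apply/eqP.
apply: small_norm_eq0 => e e0; have e20 : 0 < e / 2 by rewrite divr_gt0.
have Flim : F (ball (lim F) (e / 2)) by apply: Fcvg; exact: nbhsx_ballx.
have [_ [[y /= hy <-]]] := filter_ex (filterI (Fball _ e20) Flim).
rewrite -ball_normE /= => zy; rewrite (splitr e).
apply: le_lt_trans (ltrD zy hy).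
apply: le_trans (ler_distD `|f y - f x| _ _) _; rewrite lerD //.
  by apply: le_trans (ler_dist_dist _ _) _; rewrite opprB addrA subrK.
rewrite isof; apply: le_trans (ler_dist_dist _ _) _.
by rewrite opprB addrA subrK distrC.
Qed.

End Density.

(** * Operators on a dense domain *)

Section Restriction.
Context {R : realType} {H : completeNormedModType R[i]}.
Context (dot : {dot H for Num.conj}) (D : submodClosed H).

Definition dom_dot (x y : dom D) : R[i] := dot (val x) (val y).

Lemma val_comb c (x y : dom D) : val (c *: x + y) = c *: val x + val y.
Proof. by []. Qed.

Fact dom_dot_bilinear : bilinear_for (GRing.Scale.Law.clone _ _ *%R _)
  (GRing.Scale.Law.clone _ _ (Num.conj \; *%R) _) dom_dot.
Proof.
split=> u c x y; rewrite /dom_dot val_comb.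
  by rewrite ipDl ipZl.
by rewrite ipDr ipZr.
Qed.

HB.instance Definition _ := bilinear_isBilinear.Build R[i] (dom D) (dom D) R[i]
  _ _ dom_dot dom_dot_bilinear.

Fact dom_dot_hermitian x y :
  dom_dot x y = (-1) ^+ false * Num.conj (dom_dot y x).
Proof. exact: (hermC dot). Qed.

HB.instance Definition _ := isHermitianSesquilinear.Build R[i] (dom D) false
  Num.conj dom_dot dom_dot_hermitian.

Fact dom_dot_pos x : x != 0 -> 0 < dom_dot x x.
Proof. by move=> x0; rewrite dnorm_gt0. Qed.

HB.instance Definition _ := isDotProduct.Build R[i] (dom D) dom_dot dom_dot_pos.

Context (norm_dot : forall x : H, dot x x = `|x| ^+ 2).
Context (D_dense : dense [set` D]).

(** A vector w orthogonal to D has distance at least its norm to D, by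
    Pythagoras. *)
Lemma dense_separates h k :
  (forall x : dom D, dot h (val x) = dot k (val x)) -> h = k.
Proof.
move=> hk; apply/eqP; rewrite -subr_eq0; apply/negPn/negP; rewrite -normr_gt0.
set w := h - k => w0; have [x wx] := dense_approx D_dense w w0.
have wx0 : dot w (val x) = 0 by rewrite ipBl hk subrr.
have : `|w| ^+ 2 <= `|w - val x| ^+ 2.
  by rewrite -!norm_dot (hnormBd wx0) lerDl; exact: dnorm_ge0.
rewrite ler_pXn2r ?nnegrE // => /le_lt_trans/(_ wx).
by rewrite ltxx.
Qed.

Lemma Lplus_adjoint (A : dom D -> dom D) (x y : dom D) : Lplus dot A ->
  dom_dot (A x) y = dom_dot x (dagger dot A y).
Proof.
move=> [_ /(_ y)[y_adj ADy]].
by rewrite /dom_dot /dagger insubdK //; exact: (xgetPex 0 y_adj).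
Qed.

(** Density enters because the value of the Hilbert space adjoint at a vector of
    D is a priori only in H. *)
Lemma Lplus_of_adjoint (A B : dom D -> dom D) : linear A ->
  (forall x y, dom_dot (A x) y = dom_dot x (B y)) -> Lplus dot A.
Proof.
move=> linA AB; split=> // y.
have yB : adj_rel dot A (val y) (val (B y)) by move=> x; exact: AB.
have y_adj : adj_dom dot A (val y) by exists (val (B y)).
split=> //; suff -> : adj dot A (val y) = val (B y) by exact: valP.
apply: dense_separates => x; rewrite [LHS]ipC [RHS]ipC; congr (_^* ).
by rewrite -yB; exact: (esym (xgetPex 0 y_adj x)).
Qed.

Lemma std_algebra_of_standard (X : set (dom D -> dom D)) :
  standard_operator_algebra dot X -> std_algebra dom_dot (@dagger _ _ dot D) X.
Proof.
move=> [[XL X0 Xcomb Xcomp Xdag] XF]; split=> //.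
  by move=> A /XL LA x y; exact: Lplus_adjoint.
move=> x y; apply: XF; split.
  apply: (@Lplus_of_adjoint _ (ketbra dom_dot y x)).
    by move=> c u v; rewrite /ketbra ipDl ipZl scalerDl scalerA.
  by move=> u v; rewrite /ketbra ipZl ipZr -ipC mulrC.
exists 1, (fun=> x) => z; exists (fun=> dom_dot z y).
by rewrite big_ord1.
Qed.

Context (s : {rmorphism R[i] -> R[i]}).
Context (sE : s =1 idfun \/ s =1 Num.conj).
Implicit Types (U V : dom D -> dom D).

Let s_conj c : s c^* = (s c)^*.
Proof. by case: sE => E; rewrite !E. Qed.

Let s_nonneg (r : R[i]) : 0 <= r -> s r = r.
Proof.
case: sE => E r0; rewrite E //; exact/CrealP/ger0_real.
Qed.

Definition semiunitary_extension U (W : H -> H) :=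
  [/\ forall c x y, W (c *: x + y) = s c *: W x + W y,
      forall x y, dot (W x) (W y) = s (dot x y), set_surj setT setT W &
      continuous_extension U W].

(** W h is the vector having the distances to U x that h has to x.  Surjectivity
    of W comes from applying the same construction to the inverse of U: the
    vector h it yields for z has the distances that characterise W h = z. *)
Lemma semiunitary_extends U : semiunitary dom_dot s U ->
  exists W, semiunitary_extension U W.
Proof.
move=> UP; have [isoU surjU] := UP.
have linU := semiunitary_semilinear s_conj UP.
have distU x y : `|val (U x) - val (U y)| = `|val x - val y|.
  have -> : val (U x) - val (U y) = val (U (x - y)).
    have -> // : U (x - y) = U x - U y.
    by rewrite [x - y]addrC -[- y]scaleN1r linU rmorphN1 scaleN1r addrC.
  apply/eqP; rewrite -(eqrXn2 (ltn0Sn 1)) // -!norm_dot.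
  by apply/eqP; rewrite [LHS]isoU s_nonneg // dnorm_ge0.
have [W WU] := choice (isometry_extend D_dense distU).
have U0 : U 0 = 0.
  by have := linU (-1) 0 0; rewrite rmorphN1 !scaleN1r oppr0 !addr0 addNr.
have val0 : val (0 : dom D) = 0 by [].
have norm_eq (h k : H) : `|h| = `|k| -> dot h h = dot k k.
  by rewrite !norm_dot => ->.
have WUn h : `|W h| = `|h| by have := WU h 0; rewrite U0 val0 !subr0.
have Wval x : W (val x) = val (U x).
  by apply/eqP; rewrite -subr_eq0 -normr_eq0 WU subrr normr0.
have scaleU x : s 'i *: val (U x) = val (U ('i *: x)).
  by rewrite -['i *: x]addr0 linU U0 addr0.
have Wform h x : dot (W h) (val (U x)) = s (dot h (val x)).
  apply: (polarization sE); apply: norm_eq; rewrite ?WUn ?WU //.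
    by rewrite -Wval WUn.
  by rewrite scaleU WU.
have linW c h k : W (c *: h + k) = s c *: W h + W k.
  apply: dense_separates => y; have [x _ <-] := surjU y I.
  by rewrite ipDl ipZl !Wform ipDl ipZl rmorphD rmorphM.
have WB h k : W (h - k) = W h - W k.
  by rewrite [h - k]addrC -[- k]scaleN1r linW rmorphN1 scaleN1r addrC.
have W0 : W 0 = 0 by have := Wval 0; rewrite U0 val0.
exists W; split.
- exact: linW.
- move=> h k; apply: (polarization sE); apply: norm_eq; rewrite ?WUn -?WB ?WUn //.
  have -> : s 'i *: W k = W ('i *: k) by rewrite -['i *: k]addr0 linW W0 addr0.
  by rewrite -WB WUn.
- move=> z _.
  have /choice[G UG] : forall y, exists x, U x = y.
    by move=> y; have [x _ <-] := surjU y I; exists x.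
  have [|h hG] := isometry_extend D_dense (f := fun y => val (G y)) _ z.
    by move=> x y /=; rewrite -[LHS]distU !UG.
  exists h => //; apply/eqP; rewrite -subr_eq0; apply/eqP.
  apply: small_norm_eq0 => e e0; have e20 : 0 < e / 2 by rewrite divr_gt0.
  have [y zy] := dense_approx D_dense z e20.
  rewrite (splitr e); apply: le_lt_trans (ler_distD (val y) _ _) _.
  by rewrite [X in _ + X]distrC ltrD // -[X in val X]UG WU hG.
- split=> [h|x]; last exact: Wval.
  apply/cvgrPdist_lt => e e0; near=> k.
  rewrite -WB WUn; near: k; exact: cvgr_dist_lt.
Unshelve. all: by end_near. Qed.

End Restriction.

(** * The classification on a dense domain of a Hilbert space *)

Theorem proposition3p6 (R : realType) (H : completeNormedModType R[i])
    (dot : {dot H for Num.conj}) (norm_dot : forall x : H, dot x x = `|x| ^+ 2)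
    (D : submodClosed H) (D_dense : dense [set` D])
    (AA BB : set (dom D -> dom D))
    (AA_std : standard_operator_algebra dot AA)
    (BB_std : standard_operator_algebra dot BB)
    (Phi : (dom D -> dom D) -> (dom D -> dom D))
    (Phi_bij : set_bij AA BB Phi)
    (Phi_lin : forall (c : R[i]) (A B : dom D -> dom D), AA A -> AA B ->
      Phi (fun x => c *: A x + B x) = (fun x => c *: Phi A x + Phi B x))
    (Phi_triple : forall A B : dom D -> dom D, AA A -> AA B ->
      Phi (A \o dagger dot B \o A) = Phi A \o dagger dot (Phi B) \o Phi A) :
  (exists U V : dom D -> dom D,
    [/\ Lplus dot U, unitary_on dot U, Lplus dot V, unitary_on dot V &
        forall A, AA A -> Phi A = U \o A \o V]) \/
  (exists U' V' : dom D -> dom D,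
    [/\ antiunitary_on dot U', set_surj setT setT U',
        antiunitary_on dot V', set_surj setT setT V' &
        forall A, AA A -> Phi A = U' \o dagger dot A \o V']).
Proof.
have PhiP : triple_iso (@dagger _ _ dot D) idfun AA BB Phi by split.
have Xstd := std_algebra_of_standard norm_dot D_dense AA_std.
have Ystd := std_algebra_of_standard norm_dot D_dense BB_std.
have [[U [V [UP VP UV]]]|[U [V [UP VP UV]]]] :=
  triple_iso_classification Xstd Ystd PhiP; [left|right].
- have unitaryP (W : dom D -> dom D) : semiunitary (@dom_dot _ _ dot D) idfun W ->
      Lplus dot W /\ unitary_on dot W.
    move=> WP; split.
      have [G [isoG _] [_ WG]] :=
        semiunitary_inverse (s := idfun) (fun=> erefl) WP.
      apply: (Lplus_of_adjoint norm_dot D_dense (B := G)).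
        exact: (semiunitary_semilinear (s := idfun) (fun=> erefl) WP).
      by move=> x y; rewrite -[LHS]isoG WG.
    have [W' [lin iso surj ext]] := semiunitary_extends norm_dot D_dense
      (s := idfun) (or_introl (fun=> erefl)) WP.
    by exists W'.
  have [G GP [GV _]] := semiunitary_inverse (s := idfun) (fun=> erefl) VP.
  have [LU uU] := unitaryP U UP; have [LG uG] := unitaryP G GP.
  exists U, G; split=> // A XA; rewrite -(UV A XA).
  by apply/funext => y /=; rewrite GV.
- have antiunitaryP (W : dom D -> dom D) :
      semiunitary (@dom_dot _ _ dot D) Num.conj W -> antiunitary_on dot W.
    move=> WP; have [W' [lin iso surj ext]] := semiunitary_extends norm_dot
      D_dense (s := Num.conj) (or_intror (fun=> erefl)) WP.
    by exists W' => //; split=> // x y; rewrite iso [RHS]ipC.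
  have [G GP [GV _]] := semiunitary_inverse (s := Num.conj) (@conjCK _) VP.
  exists U, G; split; first exact: antiunitaryP.
  + by case: UP.
  + exact: antiunitaryP.
  + by case: GP.
  move=> A XA; rewrite -(UV A XA).
  by apply/funext => y /=; rewrite GV.
Qed.
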